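(* Let $n,k\ge 1$ be positive integers with $n\ge k$, let $L$ be the Laplacian matrix of the $k$-nearest neighbor platoon $\mathcal{P}(n,k)$, and let $\lambda_2(L)$ be its algebraic connectivity. Then $$\max\left\{2k-n+2,\ \frac{k(k+1)^2}{16\bar n^2}\right\}\ \le\ \lambda_2(L)\ \le\ \frac{2k(k+1)}{\bar n},$$ where $\bar n=\lfloor \frac{n}{2}\rfloor$.
   Context: For positive integers $n,k\ge 1$ with $n\ge k$, the $k$-nearest neighbor platoon $\mathcal{P}(n,k)$ is the undirected simple graph on vertices $v_1,\dots,v_n$ (vehicles in a line, in this order) in which each vertex is adjacent to its $k$ nearest vertices in front and its $k$ nearest vertices behind (or all of those, when fewer than $k$ exist); that is, $v_i$ and $v_j$ are adjacent iff $1\le |i-j|\le k$. The Laplacian is $L=D-A$, where $A$ is the $0/1$ adjacency matrix and $D$ the diagonal matrix of vertex degrees. Its eigenvalues are real and nonnegative and are ordered $0=\lambda_1(L)\le\lambda_2(L)\le\dots\le\lambda_n(L)$; $\lambda_2(L)$ is called the algebraic connectivity.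
   Formalization: Requires n ≥ 2 (for n = 1, λ₂ does not exist and n̄ = 0), and the lower bound 2k−n+2 is claimed only for k < n, since for k = n the graph is complete with λ₂ = n < n+2; the other two bounds are kept for all k ≤ n. *)

(* Defs.v *)
From mathcomp Require Import all_boot all_order all_algebra.
From mathcomp Require Import polyrcf reals.

Set Implicit Arguments.
Unset Strict Implicit.
Unset Printing Implicit Defensive.

Import Order.TTheory GRing.Theory Num.Theory.
Local Open Scope ring_scope.

(* Vertex v_i is the ordinal of value i - 1. *)
Definition platoon (n k : nat) : rel 'I_n :=
  fun i j => (0 < `|i - j| <= k)%N.
Arguments platoon n k : clear implicits.

Definition adjacency_mx (R : nzRingType) (n : nat) (e : rel 'I_n) : 'M[R]_n :=
  \matrix_(i, j) (e i j)%:R.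

Definition degree_mx (R : nzRingType) (n : nat) (e : rel 'I_n) : 'M[R]_n :=
  diag_mx (\row_i #|[pred j | e i j]|%:R).

Definition laplacian (R : nzRingType) (n : nat) (e : rel 'I_n) : 'M[R]_n :=
  degree_mx R e - adjacency_mx R e.

(* The real eigenvalues in nondecreasing order, repeated according to their
   algebraic multiplicity: rootsR lists the distinct roots in increasing order.
   For a symmetric A this list has size n. *)
Definition eigenvalues (R : rcfType) (n : nat) (A : 'M[R]_n) : seq R :=
  flatten [seq nseq (mup x (char_poly A)) x | x <- rootsR (char_poly A)].

(* Indexing starts at 0, so lambda_2 is the item of index 1; the default value 0
   is returned only when there are fewer than two real eigenvalues. *)
Definition lambda2 (R : rcfType) (n : nat) (A : 'M[R]_n) : R :=
  (eigenvalues A)`_1.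

(* Main.v *)
Require Import Defs.
From mathcomp Require Import all_boot all_order all_algebra.
From mathcomp Require Import polyrcf reals.
From mathcomp Require Import perm complex ring lra zify.
Import Order.TTheory GRing.Theory Num.Theory.
Local Open Scope ring_scope.
Local Open Scope sesquilinear_scope.

Set Implicit Arguments.
Unset Strict Implicit.
Unset Printing Implicit Defensive.

(** Everything reduces to the quadratic form of the Laplacian, which on a vector
    x is the sum of (x_j - x_i)^2 over the edges {i, j}.  By the Courant-Fischer
    principle, [lambda2] is at least c as soon as this form dominates c |x|^2 on
    the orthogonal of one vector ([lambda2_ge]), and at most c as soon as the
    form is dominated by c |x|^2 on one plane ([lambda2_le]).  Both are read off
    the spectral theorem for Hermitian matrices, a real symmetric matrix being
    viewed over the complex numbers; a complex vector then contributes the sum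
    of the values of the form at its real and at its imaginary part.

    - 2k - n + 2 <= lambda2, k < n.  On vectors of zero sum, the form of the
      complete graph is n |x|^2, and a graph whose complement has degrees at most
      n - 1 - m differs from it by at most 2 (n - 1 - m) |x|^2.  Every vertex of
      the platoon has degree at least m as soon as m <= k and m < n
      ([lambda2_ge_min_degree], [platoon_degree]).

    - k (k + 1)^2 / (16 nbar^2) <= lambda2.  For k < n, a Poincare inequality
      gives the slightly different constant k (k + 1)^2 / (3 n (n - 1))
      ([band_poincare]).  A function f on the vertices is compared with its means
      m_t over the windows {t, .., t + k}.  Each window is a clique, which
      controls f - m_t.  Consecutive means differ by
      (f (t + k + 1) - f t) / (k + 1), and the end points t and t + k + 1 are
      joined by k edge-disjoint paths of length two, which controls the path
      t |-> m_t, to which the one-dimensional Poincare inequality applies.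
      Since 3 n (n - 1) <= 16 nbar^2 unless n = 3, this is enough for n <> 3 and
      k < n.  When n = 3 or k = n the first bound suffices; for k = n it is
      used with m = n - 1 and says that lambda2 >= n.

    - lambda2 <= 2 k (k + 1) / nbar.  The test plane is spanned by the constant
      vector and the indicator of the first nbar vertices; at most k^2 edges
      cross that cut, because their end points lie within distance k of it
      ([cut_size]). *)

(** * Eigenvalues of a real symmetric matrix *)

Lemma sorted_flatten_nseq (R : realDomainType) (m : R -> nat) (s : seq R) :
  sorted <=%R s -> sorted <=%R (flatten [seq nseq (m x) x | x <- s]).
Proof.
elim: s => //= x s IH xs; have /IH {IH} := path_sorted xs.
have : all (>= x) (flatten [seq nseq (m y) y | y <- s]).
  apply/allP => y /flatten_mapP [z zs]; rewrite mem_nseq => /andP [_ /eqP ->].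
  by have /allP := order_path_min le_trans xs; apply.
set t := flatten _ => xt st; elim: (m x) => //= l IHl.
rewrite path_min_sorted //; apply/allP => y; rewrite mem_cat mem_nseq.
by move=> /orP [/andP [_ /eqP ->] //|]; move/allP: xt; apply.
Qed.

Lemma rootsR_sorted (R : rcfType) (p : {poly R}) : sorted <%R (rootsR p).
Proof. exact: sorted_roots. Qed.

Lemma eigenvalues_sorted (R : rcfType) n (A : 'M[R]_n) :
  sorted <=%R (eigenvalues A).
Proof.
apply: sorted_flatten_nseq.
by have := rootsR_sorted (char_poly A); rewrite lt_sorted_uniq_le => /andP [].
Qed.

(** Both lists contain each x with its multiplicity as a root of the
    characteristic polynomial. *)
Lemma perm_eigenvalues (R : rcfType) n (A : 'M[R]_n) (s : seq R) :
  char_poly A = \prod_(x <- s) ('X - x%:P) -> perm_eq (eigenvalues A) s.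
Proof.
move=> sA; have A0 : char_poly A != 0 by rewrite monic_neq0 // char_poly_monic.
have s_rt : rootsR (char_poly A) =i root (char_poly A).
  by move=> x; rewrite -(roots_on_rootsR A0).
have uniq_rt : uniq (rootsR (char_poly A)).
  by have := rootsR_sorted (char_poly A); rewrite lt_sorted_uniq_le => /andP [].
apply/allP => x _ /=; rewrite -(mu_prod_XsubC x s) -sA /eigenvalues.
rewrite count_flatten -!map_comp.
rewrite sumnE big_map.
rewrite (eq_bigr (fun y => if y == x then mup x (char_poly A) else 0%N)); last first.
  move=> y _ /=; rewrite count_nseq /= eq_sym.
  by case: eqP => [->|_]; rewrite ?mul1n ?mul0n.
rewrite -big_mkcond big_const_seq iter_addn_0 count_uniq_mem // s_rt.
have [_|xN] := boolP (x \in root _); first by rewrite muln1.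
by rewrite muln0 mupNroot.
Qed.

Definition qform (R : pzRingType) n (A : 'M[R]_n) (x : 'rV[R]_n) : R :=
  (x *m A *m x^T) 0 0.

Section Spectrum.
Variables (R : rcfType) (n : nat) (A : 'M[R]_n).
Hypothesis A_sym : A^T = A.
Local Notation toC := (map_mx (real_complex R)).
Local Notation Re := (@complex.Re R).
Local Notation Im := (@complex.Im R).
Local Notation sqmod z := (Re z ^+ 2 + Im z ^+ 2).

Lemma Re_sum I (r : seq I) (F : I -> R[i]) :
  Re (\sum_(i <- r) F i) = \sum_(i <- r) Re (F i).
Proof. by apply: (big_morph Re) => // -[? ?] []. Qed.

Lemma Im_sum I (r : seq I) (F : I -> R[i]) :
  Im (\sum_(i <- r) F i) = \sum_(i <- r) Im (F i).
Proof. by apply: (big_morph Im) => // -[? ?] []. Qed.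

Lemma sum_sqmod_gt0 (z : 'rV[R[i]]_n) : z != 0 -> 0 < \sum_i sqmod (z 0 i).
Proof.
have sq_ge0 i : 0 <= sqmod (z 0 i) by rewrite addr_ge0 // sqr_ge0.
move=> z0; rewrite lt_def sumr_ge0 // andbT; apply: contra_neq z0 => S0.
apply/rowP => i; rewrite mxE.
have : sqmod (z 0 i) = 0 by apply: (psumr_eq0P (fun i _ => sq_ge0 i) S0).
move/eqP; rewrite paddr_eq0 ?sqr_ge0 // !sqrf_eq0 => /andP [/eqP e /eqP f].
by apply/eqP; rewrite eq_complex e f /= eqxx.
Qed.

(** This is what reduces test vectors over the complex numbers to real ones.
    Only the real part is computed, so that B need not be symmetric. *)
Lemma Re_hform (B : 'M[R]_n) (y : 'rV[R[i]]_n) :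
  Re ((y *m toC B *m y^t*) 0 0) =
  qform B (map_mx Re y) + qform B (map_mx Im y).
Proof.
rewrite /qform !mxE Re_sum -big_split /=.
apply: eq_bigr => j _; rewrite !mxE !mulr_suml Re_sum.
rewrite -big_split /=; apply: eq_bigr => i _; rewrite !mxE.
by case: (y 0 i) (y 0 j) => a b [c d] /=; ring.
Qed.

(** The spectral theorem is available over algebraically closed fields; the
    eigenvalues are real because A is Hermitian over the complex numbers. *)
Lemma symmetric_spectrum : exists (P : 'M[R[i]]_n) (d : 'rV[R]_n),
  [/\ P \is unitarymx, toC A = P^t* *m diag_mx (toC d) *m P
    & char_poly A = \prod_i ('X - (d 0 i)%:P)].
Proof.
have AC_real : toC A \is a realmx.
  by apply/mxOverP => i j; rewrite mxE complex_real.
have AC_sym : toC A \is symmetricmx.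
  by apply/is_hermitianmxP; rewrite expr0 scale1r map_mx_id // map_trmx A_sym.
have AC_herm := realsym_hermsym AC_sym AC_real.
have /orthomx_spectralP AC := hermitian_normalmx AC_herm.
have d_real := hermitian_spectral_diag_real AC_herm.
set P := spectralmx _ in AC; set D := spectral_diag _ in AC d_real.
have P_unit : P \is unitarymx by exact: spectral_unitarymx.
have DE : D = toC (map_mx (@complex.Re R) D).
  by apply/rowP => i; rewrite !mxE RRe_real //; apply/mxOverP.
exists P, (map_mx (@complex.Re R) D); split => //.
  by rewrite -DE -invmx_unitary.
apply: (map_poly_inj (real_complex R)); rewrite map_char_poly rmorph_prod /=.
have PP : P^t* *m P = 1%:M by rewrite -invmx_unitary // mulVmx // unitarymx_unit.
have -> : char_poly (toC A) = char_poly (diag_mx D).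
  rewrite /char_poly /char_poly_mx AC invmx_unitary // !map_mxM.
  set Q := map_mx polyC (P^t*); set T := map_mx polyC P.
  have QT : Q *m T = 1%:M by rewrite -map_mxM PP map_mx1.
  have XE : 'X%:M = Q *m 'X%:M *m T by rewrite scalar_mxC -mulmxA QT mulmx1.
  rewrite [X in \det (X - _) = _]XE -mulmxBl -mulmxBr !det_mulmx mulrAC -det_mulmx.
  by rewrite QT det1 mul1r.
rewrite char_poly_trig ?diag_mx_is_trig //.
apply: eq_bigr => i _; rewrite [in LHS]DE !mxE eqxx mulr1n.
by rewrite rmorphB /= map_polyX map_polyC.
Qed.

Lemma spectral_qform (P : 'M[R[i]]_n) (d : 'rV[R]_n) (B : 'M[R]_n)
    (z : 'rV[R[i]]_n) :
  P \is unitarymx -> toC B = P^t* *m diag_mx (toC d) *m P ->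
  let y := z *m P in
  qform B (map_mx Re y) + qform B (map_mx Im y) =
  \sum_i d 0 i * sqmod (z 0 i).
Proof.
move=> P_unit BE y; have /unitarymxP PP := P_unit.
rewrite -Re_hform BE /y trmx_mul map_mxM !mulmxA.
rewrite -(mulmxA z P) PP mulmx1 -(mulmxA _ P) PP mulmx1 mul_mx_diag !mxE Re_sum.
by apply: eq_bigr => i _; rewrite !mxE; case: (z 0 i) => a b /=; ring.
Qed.

Lemma spectral_qform1 (P : 'M[R[i]]_n) (z : 'rV[R[i]]_n) :
  P \is unitarymx -> let y := z *m P in
  qform 1%:M (map_mx Re y) + qform 1%:M (map_mx Im y) =
  \sum_i sqmod (z 0 i).
Proof.
move=> P_unit /=; rewrite (@spectral_qform P (const_mx 1)) //.
  by apply: eq_bigr => i _; rewrite mxE mul1r.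
rewrite map_const_mx diag_const_mx mulmx1 map_mx1 -invmx_unitary //.
by rewrite mulVmx // unitarymx_unit.
Qed.

(** The form in which the position of [lambda2] in the spectrum is used: two
    eigenvectors have eigenvalue at most [lambda2], and all of them but the
    first one have eigenvalue at least [lambda2]. *)
Lemma lambda2_spectrum : (1 < n)%N ->
  exists (P : 'M[R[i]]_n) (d : 'rV[R]_n) (i0 i1 : 'I_n),
  [/\ P \is unitarymx, toC A = P^t* *m diag_mx (toC d) *m P,
      i0 != i1, (d 0 i0 <= lambda2 A) && (d 0 i1 <= lambda2 A)
    & forall i, i != i0 -> lambda2 A <= d 0 i].
Proof.
move=> n_gt1; have n_gt0 := ltnW n_gt1.
have [P [d [P_unit AE cA]]] := symmetric_spectrum.
have : perm_eq (eigenvalues A) [tuple d 0 i | i < n].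
  apply: perm_eigenvalues; rewrite cA big_tuple.
  by apply: eq_bigr => i _; rewrite tnth_mktuple.
case/tuple_permP => p eA.
have eAi (i : 'I_n) : (eigenvalues A)`_i = d 0 (p i).
  by rewrite eA -tnth_nth !tnth_mktuple.
have le_e (i j : 'I_n) : (i <= j)%N -> d 0 (p i) <= d 0 (p j).
  move=> ij; rewrite -!eAi; apply: (sorted_leq_nth le_trans lexx) => //.
  - exact: eigenvalues_sorted.
  - by rewrite inE eA size_tuple.
  - by rewrite inE eA size_tuple.
pose j0 := Ordinal n_gt0; pose j1 := Ordinal n_gt1.
have l2 : lambda2 A = d 0 (p j1) by rewrite /lambda2 (eAi j1).
exists P, d, (p j0), (p j1); rewrite l2 lexx le_e //; split => //.
  by rewrite (inj_eq perm_inj).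
move=> i; rewrite -(permKV p i) (inj_eq perm_inj) => Hi; apply: le_e.
by rewrite /= lt0n; apply: contra Hi => /eqP j; apply/eqP/val_inj.
Qed.

(** The plane spanned by the first two eigenvectors meets the hyperplane
    orthogonal to w in a nonzero vector, at which the Rayleigh quotient is at
    most [lambda2]. *)
Lemma lambda2_ge (w : 'rV[R]_n) (c : R) : (1 < n)%N ->
  (forall x : 'rV[R]_n, (x *m w^T) 0 0 = 0 -> c * qform 1%:M x <= qform A x) ->
  c <= lambda2 A.
Proof.
move=> n_gt1 Hc.
have [P [d [i0 [i1 [P_unit AE i01 /andP [d0 d1] _]]]]] := lambda2_spectrum n_gt1.
pose g i := (row i P *m toC w^T) 0 0.
(* z holds the coordinates, in the basis of eigenvectors, of that vector. *)
have [z [z0 zw zi]] : exists z : 'rV[R[i]]_n,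
    [/\ z != 0, (z *m P *m toC w^T) 0 0 = 0
    & forall i, z 0 i != 0 -> d 0 i <= lambda2 A].
  pose zz a b : 'rV[R[i]]_n := a *: delta_mx 0 i0 + b *: delta_mx 0 i1.
  have zz_i a b i : zz a b 0 i = a *+ (i == i0) + b *+ (i == i1).
    by rewrite !mxE !mulr_natr.
  have zz_d a b i : zz a b 0 i != 0 -> d 0 i <= lambda2 A.
    rewrite zz_i; have [->//|_] := eqVneq i i0; have [->//|_] := eqVneq i i1.
    by rewrite addr0 eqxx.
  have zz_w a b : (zz a b *m P *m toC w^T) 0 0 = a * g i0 + b * g i1.
    by rewrite !mulmxDl -!scalemxAl -!rowE mxE; congr (_ + _); rewrite mxE.
  have zz_0 a b : zz a b = 0 -> a = 0 /\ b = 0.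
    move=> /rowP zz0; move: (zz0 i0) (zz0 i1); rewrite !zz_i !mxE !eqxx.
    by rewrite (negPf i01) eq_sym (negPf i01) !mulr0n add0r addr0.
  have [g1|g1] := eqVneq (g i1) 0.
    exists (zz 0 1); rewrite zz_w g1 mul0r mulr0 addr0.
    split=> //; last exact: zz_d.
    by apply/eqP => /zz_0 [_ /eqP]; rewrite oner_eq0.
  exists (zz (g i1) (- g i0)); rewrite zz_w mulNr mulrC subrr.
  split=> //; last exact: zz_d.
  by apply/eqP => /zz_0 [/eqP]; rewrite (negPf g1).
set y := z *m P in zw.
have wC (u : 'rV[R[i]]_n) : (u *m toC w^T) 0 0 =
    Complex ((map_mx Re u *m w^T) 0 0) ((map_mx Im u *m w^T) 0 0).
  apply/eqP; rewrite eq_complex /= !mxE Re_sum Im_sum.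
  by apply/andP; split; apply/eqP; apply: eq_bigr => i _; rewrite !mxE;
    case: (u 0 i) => a b /=; ring.
have [Hr Hi] : (map_mx Re y *m w^T) 0 0 = 0 /\ (map_mx Im y *m w^T) 0 0 = 0.
  by move: zw; rewrite wC => -[-> ->].
have := lerD (Hc _ Hr) (Hc _ Hi); rewrite -mulrDr.
rewrite (spectral_qform1 z P_unit) (spectral_qform z P_unit AE) => le1.
rewrite -(ler_pM2r (sum_sqmod_gt0 z0)); apply: le_trans le1 _.
rewrite mulr_sumr; apply: ler_sum => i _.
have [->|/zi di] := eqVneq (z 0 i) 0; first by rewrite /= expr0n /= addr0 !mulr0.
by apply: ler_wpM2r; rewrite ?addr_ge0 ?sqr_ge0.
Qed.

(** Some nonzero vector of the plane spanned by w and x is orthogonal to the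
    first eigenvector, hence has Rayleigh quotient at least [lambda2]. *)
Lemma lambda2_le (w x : 'rV[R]_n) (c : R) : (1 < n)%N ->
  (forall a b, a *: w + b *: x = 0 -> a = 0 /\ b = 0) ->
  (forall a b, qform A (a *: w + b *: x) <= c * qform 1%:M (a *: w + b *: x)) ->
  lambda2 A <= c.
Proof.
move=> n_gt1 wx_free Hc.
have [P [d [i0 [_ [P_unit AE _ _ d_ge]]]]] := lambda2_spectrum n_gt1.
pose g (u : 'rV[R]_n) := (toC u *m P^t*) 0 i0.
pose mk a b := a *: toC w + b *: toC x.
have mkRe a b : map_mx Re (mk a b) = Re a *: w + Re b *: x.
  by apply/rowP => i; rewrite !mxE; case: a b => a1 a2 [b1 b2] /=; ring.
have mkIm a b : map_mx Im (mk a b) = Im a *: w + Im b *: x.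
  by apply/rowP => i; rewrite !mxE; case: a b => a1 a2 [b1 b2] /=; ring.
have mk_free a b : mk a b = 0 -> a = 0 /\ b = 0.
  move=> ab0; have := mkIm a b; have := mkRe a b; rewrite ab0.
  rewrite !map_mx0 => /esym /wx_free [ra rb] /esym /wx_free [ia ib].
  by case: a b {ab0} ra rb ia ib => a1 a2 [b1 b2] /= -> -> -> ->.
have mk_g a b : (mk a b *m P^t*) 0 i0 = a * g w + b * g x.
  by rewrite mulmxDl -!scalemxAl mxE; congr (_ + _); rewrite mxE.
have [a [b [ab0 gab]]] : exists a b, mk a b != 0 /\ (mk a b *m P^t*) 0 i0 = 0.
  have [g1|g1] := eqVneq (g x) 0.
    exists 0, 1; rewrite mk_g g1 mul0r mulr0 addr0; split=> //.
    by apply/eqP => /mk_free [_ /eqP]; rewrite oner_eq0.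
  exists (g x), (- g w); rewrite mk_g mulNr mulrC subrr; split=> //.
  by apply/eqP => /mk_free [/eqP]; rewrite (negPf g1).
pose z := mk a b *m P^t*.
have PP : P^t* *m P = 1%:M by rewrite -invmx_unitary // mulVmx // unitarymx_unit.
have zP : z *m P = mk a b by rewrite -mulmxA PP mulmx1.
have z0 : z != 0 by apply: contra_neq ab0 => z0; rewrite -zP z0 mul0mx.
have zi0 : z 0 i0 = 0 by [].
clearbody z.
have := lerD (Hc (Re a) (Re b)) (Hc (Im a) (Im b)).
rewrite -mulrDr -mkRe -mkIm -zP (spectral_qform1 z P_unit).
rewrite (spectral_qform z P_unit AE) => le1.
rewrite -(ler_pM2r (sum_sqmod_gt0 z0)); apply: le_trans le1.
rewrite mulr_sumr; apply: ler_sum => i _.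
have [->|/d_ge di] := eqVneq i i0; first by rewrite zi0 /= expr0n /= addr0 !mulr0.
by apply: ler_wpM2r; rewrite ?addr_ge0 ?sqr_ge0.
Qed.
End Spectrum.

(** * A Poincare inequality for functions on a band *)

Section Band.
Variable R : realFieldType.

Lemma sum_symmetric n (G : 'I_n -> 'I_n -> R) :
  (forall i j, G i j = G j i) -> (forall i, G i i = 0) ->
  \sum_i \sum_j G i j = 2 * \sum_(i < n) \sum_(j < n | (i < j)%N) G i j.
Proof.
move=> Gsym G0; have -> : \sum_i \sum_j G i j =
    \sum_(i < n) \sum_(j < n | (i < j)%N) G i j + \sum_(i < n) \sum_(j < n | (j < i)%N) G i j.
  rewrite -big_split /=; apply: eq_bigr => i _.
  rewrite [X in X + _]big_mkcond [X in _ + X]big_mkcond -big_split /=.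
  apply: eq_bigr => j _; case: ltngtP => [_|_|/val_inj ->]; rewrite ?G0; ring.
rewrite mulr_natl mulr2n; congr (_ + _).
rewrite (exchange_big_dep xpredT) //=; apply: eq_bigr => i _.
by apply: eq_bigr => j _; rewrite Gsym.
Qed.

Lemma sum_sqr_differences n (g : 'I_n -> R) :
  \sum_i \sum_j (g i - g j) ^+ 2 = 2 * (n%:R * \sum_i g i ^+ 2 - (\sum_i g i) ^+ 2).
Proof.
transitivity (\sum_i (n%:R * g i ^+ 2 - 2 * g i * (\sum_j g j) + \sum_j g j ^+ 2)).
  apply: eq_bigr => i _; rewrite [_%:R * _]mulr_natl -[in _ *+ n](card_ord n) -sumr_const.
  rewrite mulr_sumr -sumrB -big_split /=; apply: eq_bigr => j _; ring.
rewrite big_split /= sumrB -mulr_sumr -mulr_suml sumr_const card_ord -mulr_natl.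
by rewrite -mulr_sumr; ring.
Qed.

Lemma mulr_natl_sum m (c : R) : m%:R * c = \sum_(0 <= i < m) c.
Proof. by rewrite sumr_const_nat subn0 mulr_natl. Qed.

Lemma sqr_sum_le n (g : nat -> R) :
  (\sum_(0 <= i < n) g i) ^+ 2 <= n%:R * \sum_(0 <= i < n) g i ^+ 2.
Proof.
have := sum_sqr_differences (fun i : 'I_n => g i); rewrite !big_mkord => E.
suff : 0 <= \sum_(i < n) \sum_(j < n) (g i - g j) ^+ 2 by rewrite E; lra.
by apply: sumr_ge0 => i _; apply: sumr_ge0 => j _; apply: sqr_ge0.
Qed.

(** Summation by differences: d.+1 is the distance between the two indices. *)
Lemma band_sum n k (F : nat -> nat -> R) :
  \sum_(0 <= i < n) \sum_(0 <= j < n | (i < j <= i + k)%N) F i j =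
  \sum_(0 <= d < k) \sum_(0 <= i < n - d.+1) F i (i + d.+1)%N.
Proof.
elim: k => [|k IHk].
  rewrite [RHS]big_nil big1 // => i _; apply: big_pred0 => j.
  by rewrite addn0; case: leqP.
rewrite big_nat_recr //= -{}IHk.
have -> : \sum_(0 <= i < n - k.+1) F i (i + k.+1)%N =
    \sum_(0 <= i < n) \sum_(0 <= j < n | j == i + k.+1) F i j.
  rewrite (big_cat_nat (n := n - k.+1) (p := n)) ?leq_subr //=.
  rewrite [X in _ + X]big_nat_cond [X in _ + X]big1 ?addr0 => [|i].
    rewrite big_nat_cond [RHS]big_nat_cond.
    by apply: eq_bigr => i iP; rewrite big_nat1_eq ifT //; lia.
  by move=> iP; rewrite big_nat1_eq ifF //; lia.
rewrite -big_split /=; apply: eq_bigr => i _.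
rewrite [RHS]addrC big_mkcond /= [X in _ = X + _]big_mkcond [X in _ = _ + X]big_mkcond.
rewrite -big_split /=; apply: eq_bigr => j _.
have [->|jP] := eqVneq j (i + k.+1)%N.
  have -> : (i < i + k.+1 <= i + k.+1)%N by lia.
  by have -> : (i < i + k.+1 <= i + k)%N = false; [lia | rewrite addr0].
by rewrite add0r; congr (if _ then _ else _); lia.
Qed.

Lemma sum_indicator n a k : (\sum_(0 <= j < n) (a <= j < a + k) = minn k (n - a))%N.
Proof.
elim: n => [|n IHn]; first by rewrite big_nil; lia.
by rewrite big_nat_recr //= IHn; lia.
Qed.

(** In a window of k.+1 indices, the band condition holds for all pairs, so the
    band sum is the pairwise expression of the variance. *)
Lemma clique_band k (g : nat -> R) :
  \sum_(0 <= d < k) \sum_(0 <= i < k - d) (g (i + d.+1)%N - g i) ^+ 2 =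
  k.+1%:R * \sum_(0 <= i < k.+1) g i ^+ 2 - (\sum_(0 <= i < k.+1) g i) ^+ 2.
Proof.
have := band_sum k.+1 k (fun i j => (g j - g i) ^+ 2).
under [X in _ = X -> _]eq_bigr => d _ do rewrite subSS.
move=> <-; apply: (mulfI (x := 2)); first by rewrite pnatr_eq0.
rewrite !big_mkord -(sum_sqr_differences (fun i : 'I_k.+1 => g i)).
rewrite (sum_symmetric (G := fun i j : 'I_k.+1 => (g i - g j) ^+ 2)) => [||i]; last 2 first.
- by move=> i j; ring.
- by rewrite subrr expr0n.
congr (_ * _); apply: eq_bigr => i _; rewrite big_mkord; apply: eq_big => [j|j _]; last by ring.
by have := ltn_ord j; lia.
Qed.

(** The domain is {0, .., N + k}, so that the windows {t, .., t + k} are those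
    with t <= N. *)
Section Poincare.
Variables (N k : nat) (f : nat -> R).
Hypothesis k_gt0 : (0 < k)%N.
Local Notation n := (N + k.+1)%N.
Local Notation K := (k.+1%:R : R).
Let q i j : R := (f j - f i) ^+ 2.
Let Q : R := \sum_(0 <= d < k) \sum_(0 <= i < n - d.+1) q i (i + d.+1).
Let S t : R := \sum_(0 <= s < k.+1) f (t + s)%N.

Let q_ge0 i j : 0 <= q i j. Proof. exact: sqr_ge0. Qed.
Let K_gt0 : 0 < K. Proof. by []. Qed.

(** The edges split into those whose first end point is before N and those of
    the last window; this keeps [window_variance] from counting an edge twice. *)
Lemma window_split :
  Q = \sum_(0 <= t < N) \sum_(0 <= d < k) q t (t + d.+1)
    + \sum_(0 <= d < k) \sum_(0 <= i < k - d) q (N + i) (N + i + d.+1).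
Proof.
rewrite [X in _ = X + _]exchange_big -big_split /= /Q.
apply: eq_big_nat => d /andP [_ dk].
rewrite (big_cat_nat (n := N)) //=; last by lia.
congr (_ + _); rewrite -[X in \sum_(X <= _ < _) _]add0n big_addn.
have -> : (N + k.+1 - d.+1 - N = k - d)%N by lia.
by apply: eq_bigr => i _; rewrite addnC.
Qed.

Lemma window_out : \sum_(0 <= t < N) \sum_(0 <= s < k) q t (t + s.+1) <= Q.
Proof.
rewrite window_split lerDl; apply: sumr_ge0 => d _.
by apply: sumr_ge0 => i _.
Qed.

Lemma window_in : \sum_(0 <= t < N) \sum_(0 <= s < k) q (t + s.+1) (t + k.+1) <= Q.
Proof.
rewrite exchange_big /= big_nat_rev /= /Q.
apply: ler_sum_nat => d /andP [_ dk].
have -> : (n - d.+1 = N + (k - d))%N by lia.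
rewrite [leRHS](big_cat_nat (n := (k - d)%N)) //=; last by lia.
rewrite [X in _ + X](_ : _ = \sum_(0 <= t < N) q (t + (0 + k - d.+1).+1) (t + k.+1)).
  by rewrite lerDr; apply: sumr_ge0.
rewrite -[X in \sum_(X <= _ < _) _ = _]add0n big_addn addnK; apply: eq_bigr => t _.
by congr q; lia.
Qed.

(** Only the terms at t and at t + k.+1 survive in S t.+1 - S t; their difference
    is split at each of the k vertices in between, and averaged. *)
Lemma window_step : k%:R * \sum_(0 <= t < N) (S t.+1 - S t) ^+ 2 <= 4 * Q.
Proof.
apply: (@le_trans _ _ (2 * (\sum_(0 <= t < N) \sum_(0 <= s < k) q t (t + s.+1)
   + \sum_(0 <= t < N) \sum_(0 <= s < k) q (t + s.+1) (t + k.+1)))).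
  rewrite -big_split /= !mulr_sumr; apply: ler_sum => t _.
  have -> : S t.+1 - S t = f (t + k.+1)%N - f t.
    rewrite /S big_nat_recr //= [X in _ - X]big_nat_recl //= addn0.
    under [X in _ - (_ + X)]eq_bigr => i _ do rewrite addnS -addSn.
    by rewrite addSnnS; ring.
  rewrite -big_split /= mulr_sumr (mulr_natl_sum k).
  apply: ler_sum => s _; rewrite /q.
  have := sqr_ge0 (f (t + s.+1)%N - f t - (f (t + k.+1)%N - f (t + s.+1)%N)).
  by rewrite !expr2; lra.
by have := window_out; have := window_in; lra.
Qed.

Lemma window_dist t : (t <= N)%N ->
  (S t - S 0%N) ^+ 2 <= t%:R * \sum_(0 <= i < N) (S i.+1 - S i) ^+ 2.
Proof.
move=> tN; rewrite -(telescope_sumr S (leq0n t)).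
apply: le_trans (sqr_sum_le _ _) _; apply: ler_wpM2l => //.
rewrite [leRHS](big_cat_nat (n := t)) //= lerDl.
by apply: sumr_ge0 => i _; apply: sqr_ge0.
Qed.

(** A vertex a < N is compared with the mean over the window starting at a, by
    Cauchy-Schwarz; the vertices from N on with the mean over the last window, by
    the exact formula for the variance. *)
Lemma window_variance :
  K * \sum_(0 <= a < n) (f a - S (minn a N) / K) ^+ 2 <= Q.
Proof.
rewrite (big_cat_nat (n := N)) //=; last by lia.
rewrite mulrDr window_split; apply: lerD.
  rewrite mulr_sumr; apply: ler_sum_nat => t /andP [_ tN].
  have -> : minn t N = t by lia.
  have -> : f t - S t / K = (\sum_(0 <= s < k) (f t - f (t + s.+1)%N)) / K.
    rewrite sumrB sumr_const_nat subn0 /S big_nat_recl //= addn0.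
    by rewrite -mulr_natl; field; rewrite ?nat1r ?natr1 pnatr_eq0.
  set X := \sum_(0 <= s < k) _.
  have -> : K * (X / K) ^+ 2 = X ^+ 2 / K by field; rewrite ?nat1r ?natr1 pnatr_eq0.
  rewrite ler_pdivrMr // mulrC; apply: le_trans (sqr_sum_le _ _) _.
  rewrite (eq_bigr (fun s => q t (t + s.+1))) => [|s _]; last by rewrite /q; ring.
  by apply: ler_wpM2r; rewrite ?ler_nat // sumr_ge0.
have -> : \sum_(N <= a < n) (f a - S (minn a N) / K) ^+ 2 =
    \sum_(0 <= s < k.+1) (f (N + s)%N - S N / K) ^+ 2.
  rewrite -[X in \sum_(X <= _ < _) _ = _]add0n big_addn addKn.
  by apply: eq_bigr => s _; rewrite addnC (minn_idPr _) ?leq_addr.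
have := clique_band k (fun s => f (N + s)%N); rewrite -/(S N) => E.
rewrite [leRHS](eq_bigr (fun d => \sum_(0 <= i < k - d)
  (f (N + (i + d.+1))%N - f (N + i)%N) ^+ 2)) => [|d _]; last first.
  by apply: eq_bigr => i _; rewrite /q addnA.
rewrite E; set F2 := \sum_(0 <= i < k.+1) f (N + i)%N ^+ 2.
have -> (c : R) : \sum_(0 <= s < k.+1) (f (N + s)%N - c) ^+ 2 =
    F2 - 2 * c * S N + K * c ^+ 2.
  rewrite /F2 /S mulr_sumr -sumrB (mulr_natl_sum k.+1) -big_split /=.
  by apply: eq_bigr => s _; ring.
rewrite le_eqVlt; apply/orP; left; apply/eqP.
by field; rewrite ?nat1r ?natr1 pnatr_eq0.
Qed.

Lemma sum_clipped : (\sum_(0 <= a < n) minn a N).*2 = (N * (N + k.*2.+1))%N.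
Proof.
rewrite (big_cat_nat (n := N)) //=; last by lia.
rewrite [X in (_ + X)%N](eq_big_nat _ _ (F2 := fun=> N)); last by move=> i; lia.
rewrite sum_nat_const_nat addKn (eq_big_nat _ _ (F2 := id)); last by move=> i; lia.
have := bin2_sum N; rewrite bin2 => ->.
case: N => [|p] /=; first by rewrite muln0.
have : (p.+1 * p = (p.+1 * p)./2.*2)%N by rewrite -[LHS]odd_double_half oddM /= andNb.
by lia.
Qed.

(** As f has zero sum, its sum of squares only grows when a constant c is
    subtracted; c is the mean over the first window.  Each f a - c is the sum of
    f a - m and m - c, with m the mean over the window attached to a.  With the
    weights 3 and 3 / 2 in (x + y)^2 <= 3 x^2 + 3 / 2 y^2, the two contributions
    are 3 k (k + 1) and 3 N (N + 2 k + 1), up to a common factor, and add up to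
    3 (N + k) (N + k + 1). *)
Theorem band_poincare : \sum_(0 <= i < n) f i = 0 ->
  k%:R * K ^+ 2 * (\sum_(0 <= i < n) f i ^+ 2) <= 3 * (N + k)%:R * n%:R * Q.
Proof.
move=> f0; pose c := S 0%N / K.
pose V := \sum_(0 <= a < n) (f a - S (minn a N) / K) ^+ 2.
pose E := \sum_(0 <= i < N) (S i.+1 - S i) ^+ 2.
pose T : R := (\sum_(0 <= a < n) minn a N)%:R.
have fc : \sum_(0 <= i < n) f i ^+ 2 <= \sum_(0 <= i < n) (f i - c) ^+ 2.
  have -> : \sum_(0 <= i < n) (f i - c) ^+ 2 = \sum_(0 <= i < n) f i ^+ 2
      - 2 * c * \sum_(0 <= i < n) f i + n%:R * c ^+ 2.
    rewrite (mulr_natl_sum n) [2 * c * _]mulr_sumr -sumrB -big_split /=.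
    by apply: eq_bigr => s _; ring.
  rewrite f0 mulr0 subr0.
  by rewrite lerDl mulr_ge0 // sqr_ge0.
have split_c : \sum_(0 <= i < n) (f i - c) ^+ 2 <= 3 * V + 3 / 2 / K ^+ 2 * (T * E).
  rewrite /V /T natr_sum mulr_suml !mulr_sumr -big_split /=.
  apply: ler_sum => a _; set t := minn a N.
  have /window_dist : (t <= N)%N by exact: geq_minr.
  rewrite -/E => Dt.
  have -> : 3 / 2 / K ^+ 2 * (t%:R * E) = 3 / 2 * (t%:R * E / K ^+ 2) by ring.
  have : (S t / K - c) ^+ 2 <= t%:R * E / K ^+ 2.
    by rewrite /c -mulrBl exprMn exprVn ler_pM2r // invr_gt0 exprn_gt0.
  have -> : f a - c = (f a - S t / K) + (S t / K - c) by ring.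
  move: (f a - S t / K) (S t / K - c) (t%:R * E / K ^+ 2) => d e u e_u.
  by have := sqr_ge0 (2 * d - e); nra.
have := window_variance; rewrite -/V => HV.
have := window_step; rewrite -/E => HE.
have HT : 2 * T = N%:R * (N%:R + 2 * k%:R + 1).
  rewrite /T -natrM mul2n sum_clipped.
  by rewrite (_ : N + k.*2.+1 = N + 2 * k + 1)%N ?natrM ?(natrD, natrM) //; lia.
have k0 : 0 < k%:R :> R by rewrite ltr0n.
have T0 : 0 <= T by [].
apply: (@le_trans _ _ (k%:R * K ^+ 2 * (3 * V + 3 / 2 / K ^+ 2 * (T * E)))).
  by apply: ler_wpM2l; [rewrite mulr_ge0 ?exprn_ge0 | exact: le_trans split_c].
have -> : k%:R * K ^+ 2 * (3 * V + 3 / 2 / K ^+ 2 * (T * E)) =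
   3 * (k%:R * K) * (K * V) + 3 / 2 * T * (k%:R * E).
  by field; rewrite ?nat1r ?natr1 pnatr_eq0.
have H1 : 3 * (k%:R * K) * (K * V) <= 3 * (k%:R * K) * Q.
  by apply: ler_wpM2l HV; do ?apply: mulr_ge0.
have H2 : 3 / 2 * T * (k%:R * E) <= 3 / 2 * T * (4 * Q).
  by apply: ler_wpM2l HE; rewrite mulr_ge0 // divr_ge0.
apply: le_trans (lerD H1 H2) _.
have -> : 3 / 2 * T * (4 * Q) = 3 * (2 * T) * Q by field.
rewrite HT !natrD -natr1 le_eqVlt; apply/orP; left; apply/eqP.
by ring.
Qed.
End Poincare.
End Band.

(** * Laplacian forms *)

Lemma qform1 (R : comNzRingType) n (x : 'rV[R]_n) : qform 1%:M x = \sum_i x 0 i ^+ 2.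
Proof. by rewrite /qform mulmx1 mxE; apply: eq_bigr => i _; rewrite mxE expr2. Qed.

Section Laplacian.
Variables (R : rcfType) (n : nat) (e : rel 'I_n).
Hypothesis e_sym : symmetric e.

Lemma laplacian_sym : (laplacian R e)^T = laplacian R e.
Proof.
rewrite /laplacian linearB /= tr_diag_mx; congr (_ - _).
by apply/matrixP => i j; rewrite !mxE e_sym.
Qed.

Lemma degreeE i : #|[pred j | e i j]|%:R = \sum_j (e i j)%:R :> R.
Proof.
rewrite -sum1_card natr_sum big_mkcond /=.
by apply: eq_bigr => j _; rewrite inE; case: (e i j).
Qed.

Lemma qform_laplacian (x : 'rV[R]_n) :
  2 * qform (laplacian R e) x = \sum_i \sum_j (e i j)%:R * (x 0 i - x 0 j) ^+ 2.
Proof.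
pose D := \sum_i \sum_j (e i j)%:R * x 0 i ^+ 2.
pose X := \sum_i \sum_j (e i j)%:R * (x 0 i * x 0 j).
have DE : D = \sum_i \sum_j (e i j)%:R * x 0 j ^+ 2.
  by rewrite /D exchange_big; do 2 apply: eq_bigr => ? _; rewrite e_sym.
have -> : qform (laplacian R e) x = D - X.
  rewrite /qform /laplacian mulmxBr mulmxBl mxE; congr (_ + _).
    rewrite /degree_mx mul_mx_diag mxE; apply: eq_bigr => i _.
    by rewrite !mxE degreeE -mulr_suml; ring.
  rewrite !mxE; congr (- _); rewrite /X exchange_big; apply: eq_bigr => j _.
  by rewrite !mxE mulr_suml; apply: eq_bigr => i _; rewrite !mxE; ring.
transitivity (D + D - 2 * X); first by ring.
rewrite {2}DE /D /X mulr_sumr -big_split -sumrB; apply: eq_bigr => i _ /=.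
rewrite mulr_sumr -big_split -sumrB; apply: eq_bigr => j _ /=; ring.
Qed.

Lemma mul_onesE (x : 'rV[R]_n) : (x *m (const_mx 1 : 'rV[R]_n)^T) 0 0 = \sum_i x 0 i.
Proof. by rewrite mxE; apply: eq_bigr => i _; rewrite !mxE mulr1. Qed.

(** On vectors of zero sum the form of the complete graph is n |x|^2.  The edges
    missing from e contribute at most 2 (x_i^2 + x_j^2) each, hence in total at
    most 2 |x|^2 times the maximal degree n - 1 - m of the complement. *)
Lemma lambda2_ge_min_degree (m : nat) : (1 < n)%N -> irreflexive e ->
  (forall i, m <= #|[pred j | e i j]|)%N ->
  2 * m%:R - n%:R + 2 <= lambda2 (laplacian R e).
Proof.
move=> n_gt1 e_irr deg_ge; apply: (lambda2_ge laplacian_sym (w := const_mx 1)) => // x.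
rewrite mul_onesE qform1 => x0; set S := \sum_i _ ^+ 2.
(* The adjacency matrix of the complement. *)
pose c i j : R := (i != j)%:R - (e i j)%:R.
have c_ge0 i j : 0 <= c i j.
  rewrite /c; have [->|_] := eqVneq i j; first by rewrite e_irr subrr.
  by case: (e i j); rewrite ?subrr ?subr0.
have c_sym i j : c i j = c j i by rewrite /c eq_sym e_sym.
have c_sum i : \sum_j c i j <= n%:R - 1 - m%:R.
  rewrite sumrB -degreeE; apply: lerB; last by rewrite ler_nat.
  rewrite (bigD1 i) //= eqxx add0r (eq_bigr (fun=> 1)) => [|j ji]; last by rewrite eq_sym ji.
  rewrite sumr_const cardC1 card_ord; case: n n_gt1 => // p _.
  by rewrite /= -natr1 addrK.
have E1 := sum_sqr_differences (fun i => x 0 i).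
rewrite x0 expr0n /= subr0 -/S in E1.
have E2 : \sum_i \sum_j c i j * (x 0 i - x 0 j) ^+ 2 <= 4 * (n%:R - 1 - m%:R) * S.
  apply: (@le_trans _ _ (\sum_i \sum_j (2 * c i j * x 0 i ^+ 2 + 2 * c i j * x 0 j ^+ 2))).
    apply: ler_sum => i _; apply: ler_sum => j _.
    have -> : 2 * c i j * x 0 i ^+ 2 + 2 * c i j * x 0 j ^+ 2 =
      c i j * (2 * x 0 i ^+ 2 + 2 * x 0 j ^+ 2) by ring.
    apply: ler_wpM2l => //; have := sqr_ge0 (x 0 i + x 0 j); rewrite !expr2; lra.
  under eq_bigr => i _ do rewrite big_split.
  rewrite big_split /= [X in _ + X]exchange_big /=.
  have E : \sum_i \sum_j 2 * c i j * x 0 i ^+ 2 <= 2 * (n%:R - 1 - m%:R) * S.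
    rewrite /S mulr_sumr; apply: ler_sum => i _; rewrite -mulr_suml -mulr_sumr.
    by apply: ler_wpM2r; rewrite ?sqr_ge0 // ler_pM2l.
  rewrite [X in _ + X](_ : _ = \sum_i \sum_j 2 * c i j * x 0 i ^+ 2); last first.
    by apply: eq_bigr => i _; apply: eq_bigr => j _; rewrite c_sym.
  lra.
have E3 : 2 * qform (laplacian R e) x =
    \sum_i \sum_j (x 0 i - x 0 j) ^+ 2 - \sum_i \sum_j c i j * (x 0 i - x 0 j) ^+ 2.
  rewrite qform_laplacian -sumrB; apply: eq_bigr => i _; rewrite -sumrB.
  apply: eq_bigr => j _; rewrite /c; have [->|_] := eqVneq i j.
    by rewrite subrr expr0n /= !mulr0 subr0.
  by rewrite /=; ring.
(* Naming these products makes the conclusion a linear consequence. *)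
have [p pS] : exists p, p = m%:R * S by exists (m%:R * S).
have [r rS] : exists r, r = n%:R * S by exists (n%:R * S).
have -> : (2 * m%:R - n%:R + 2) * S = 2 * p - r + 2 * S by rewrite pS rS; ring.
have E2' : 4 * (n%:R - 1 - m%:R) * S = 4 * r - 4 * S - 4 * p by rewrite pS rS; ring.
rewrite -rS in E1; lra.
Qed.
End Laplacian.

Lemma platoonE n k (i j : 'I_n) : (i < j)%N -> platoon n k i j = (j <= i + k)%N.
Proof. by rewrite /platoon; lia. Qed.

Lemma platoon_sym n k : symmetric (platoon n k).
Proof. by move=> i j; rewrite /platoon; lia. Qed.

Lemma platoon_irr n k : irreflexive (platoon n k).
Proof. by move=> i; rewrite /platoon; lia. Qed.

(** Some m.+1 consecutive vertices contain i; the other m are adjacent to i. *)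
Lemma platoon_degree n k m (i : 'I_n) : (m <= k)%N -> (m < n)%N ->
  (m <= #|[pred j | platoon n k i j]|)%N.
Proof.
move=> mk mn; pose t := minn i (n - m.+1).
have tn (s : 'I_m.+1) : (t + s < n)%N by rewrite /t; have := ltn_ord s; lia.
pose h s := Ordinal (tn s).
have h_inj : injective h by move=> a b /(congr1 val) /= /addnI /val_inj.
have : (#|[set h s | s in 'I_m.+1]| <= #|[predU1 i & [pred j | platoon n k i j]]|)%N.
  apply/subset_leq_card/subsetP => j /imsetP [s _ ->]; rewrite !inE.
  have [//|/eqP hi] := eqVneq (h s) i; rewrite /platoon /=.
  have : t + s <> i by move=> ti; apply: hi; apply: val_inj.
  by rewrite /t; have := ltn_ord s; have := ltn_ord i; lia.
by rewrite card_imset // card_ord cardU1 inE platoon_irr /= add1n ltnS.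
Qed.

Lemma qform_platoon (R : rcfType) n k (x : 'rV[R]_n) :
  qform (laplacian R (platoon n k)) x =
  \sum_(i < n) \sum_(j < n | (i < j <= i + k)%N) (x 0 j - x 0 i) ^+ 2.
Proof.
apply: (mulfI (x := 2)); first by rewrite pnatr_eq0.
rewrite (qform_laplacian (@platoon_sym n k)) sum_symmetric => [||i]; last 2 first.
- by move=> i j; rewrite platoon_sym; ring.
- by rewrite subrr expr0n mulr0.
congr (_ * _); apply: eq_bigr => i _.
rewrite big_mkcond [RHS]big_mkcond; apply: eq_bigr => j _.
case: ltnP => //= ij; rewrite platoonE //; case: ifP => _; rewrite /=; ring.
Qed.

Section Bounds.
Variables (R : rcfType) (n k : nat).
Hypotheses (n_gt1 : (1 < n)%N) (k_gt0 : (0 < k)%N).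
Local Notation L := (laplacian R (platoon n k)).

Lemma lambda2_platoon_ge_poincare : (k < n)%N ->
  k%:R * (k%:R + 1) ^+ 2 / (3 * n%:R * (n%:R - 1)) <= lambda2 L.
Proof.
move=> kn; apply: (lambda2_ge (laplacian_sym R (@platoon_sym n k)) (w := const_mx 1)) => // x.
rewrite mul_onesE qform1 qform_platoon => x0.
(* The vector as a function on nat; the default value is never reached. *)
pose f i := oapp (fun o : 'I_n => x 0 o) 0 (insub i).
have fE (i : 'I_n) : x 0 i = f i by rewrite /f valK.
pose N := (n - k.+1)%N; have nE : (N + k.+1 = n)%N by rewrite subnK.
under [X in _ * X]eq_bigr => i _ do rewrite fE.
under [leRHS]eq_bigr => i _ do under eq_bigr => j _ do rewrite !fE.
rewrite -(big_mkord xpredT (fun i => f i ^+ 2)).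
under [leRHS]eq_bigr => i _ do
  rewrite -(big_mkord (fun j => i < j <= i + k)%N (fun j => (f j - f i) ^+ 2)).
rewrite -(big_mkord xpredT (fun i => \sum_(0 <= j < n | (i < j <= i + k)%N) (f j - f i) ^+ 2)).
rewrite (band_sum n k (fun i j => (f j - f i) ^+ 2)).
have f0 : \sum_(0 <= i < N + k.+1) f i = 0.
  by rewrite nE big_mkord -[RHS]x0; apply: eq_bigr => i _; rewrite fE.
have := band_poincare k_gt0 f0; rewrite nE => Hp.
have n1 : 0 < n%:R - 1 :> R by rewrite subr_gt0 ltr1n.
have n0 : 0 < n%:R :> R by rewrite ltr0n; lia.
rewrite mulrAC ler_pdivrMr ?mulr_gt0 // natr1.
apply: le_trans Hp _; rewrite le_eqVlt; apply/orP; left; apply/eqP.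
have -> : (N + k)%:R = n%:R - 1 :> R by rewrite -nE addnS -natr1 addrK.
by ring.
Qed.

(** An edge crossing the cut before m joins one of the k vertices before it to
    one of the k vertices after it. *)
Lemma cut_size m :
  (\sum_(i < n) \sum_(j < n | i < j <= i + k) (i < m <= j) <= k * k)%N.
Proof.
apply: (@leq_trans (\sum_(i < n) \sum_(j < n) (m - k <= i < m - k + k) * (m <= j < m + k))).
  apply: leq_sum => i _; rewrite big_mkcond; apply: leq_sum => j _.
  case: ifP => // ij; have [imj|//] := boolP (i < m <= j)%N.
  have -> : (m - k <= i < m - k + k)%N by lia.
  by have -> : (m <= j < m + k)%N by lia.
rewrite -big_distrlr /= -(big_mkord xpredT (fun i => nat_of_bool (m - k <= i < m - k + k)%N)).
rewrite -(big_mkord xpredT (fun i => nat_of_bool (m <= i < m + k)%N)) !sum_indicator.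
by apply: leq_mul; apply: geq_minl.
Qed.

(** On the test plane, u = a + b x has |u|^2 >= m ((a + b)^2 + a^2) >= m b^2 / 2,
    while the form at u is b^2 times the number of edges in the cut. *)
Lemma lambda2_platoon_le :
  lambda2 L <= 2 * k%:R * (k%:R + 1) / n./2%:R.
Proof.
pose m := n./2; have m_gt0 : (0 < m)%N by rewrite /m; lia.
have mn : (m <= n - m)%N by rewrite /m; lia.
have mR : 0 < m%:R :> R by rewrite ltr0n.
pose x : 'rV[R]_n := \row_i (i < m)%:R.
apply: (lambda2_le (laplacian_sym R (@platoon_sym n k)) (w := const_mx 1) (x := x)) => //.
  move=> a b ab0.
  have /rowP /(_ (Ordinal (ltnW n_gt1))) := ab0; rewrite !mxE /= m_gt0 !mulr1.
  have lt_m : (m < n)%N by lia.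
  have /rowP /(_ (Ordinal lt_m)) := ab0; rewrite !mxE /= ltnn mulr1 mulr0 addr0.
  by move=> ->; rewrite add0r.
move=> a b; set u := a *: _ + _; have uE i : u 0 i = a + b * (i < m)%:R by rewrite !mxE mulr1.
rewrite qform1 qform_platoon.
have -> : \sum_i u 0 i ^+ 2 = m%:R * (a + b) ^+ 2 + (n - m)%:R * a ^+ 2.
  under eq_bigr => i _ do rewrite uE.
  rewrite -(big_mkord xpredT (fun i => (a + b * (i < m)%:R) ^+ 2)).
  rewrite (big_cat_nat (n := m)) //=; last by lia.
  rewrite mulr_natl_sum (mulr_natl_sum (n - m)).
  rewrite -[X in _ + \sum_(X <= _ < _) _ = _]add0n big_addn.
  congr (_ + _); apply: eq_big_nat => i im.
    by rewrite (_ : (i < m)%N) ?mulr1 //; lia.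
  by rewrite (_ : (i + m < m)%N = false) ?mulr0 ?addr0 //; lia.
have cut : \sum_(i < n) \sum_(j < n | (i < j <= i + k)%N) (u 0 j - u 0 i) ^+ 2
    <= b ^+ 2 * (k%:R * k%:R).
  rewrite -natrM; apply: (@le_trans _ _ (b ^+ 2 *
    (\sum_(i < n) \sum_(j < n | i < j <= i + k) (i < m <= j))%N%:R)); last first.
    by apply: ler_wpM2l; rewrite ?sqr_ge0 // ler_nat cut_size.
  rewrite natr_sum mulr_sumr; apply: ler_sum => i _.
  rewrite natr_sum mulr_sumr; apply: ler_sum => j /andP [ij _].
  rewrite !uE le_eqVlt; apply/orP; left; apply/eqP.
  case: (ltnP i m) => im; case: (ltnP j m) => jm /=; try ring.
  by lia.
apply: le_trans cut _; rewrite [leRHS]mulrAC ler_pdivlMr //.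
have mnR : m%:R <= (n - m)%:R :> R by rewrite ler_nat.
have k0 : 0 < k%:R :> R by rewrite ltr0n.
apply: (@le_trans _ _ (2 * k%:R * (k%:R + 1) * (m%:R * ((a + b) ^+ 2 + a ^+ 2)))); last first.
  apply: ler_wpM2l; first by rewrite !mulr_ge0 // addr_ge0.
  by rewrite mulrDr lerD2l ler_wpM2r // sqr_ge0.
have ab : b ^+ 2 <= 2 * ((a + b) ^+ 2 + a ^+ 2).
  by have := sqr_ge0 (2 * a + b); rewrite !expr2; lra.
have -> : b ^+ 2 * (k%:R * k%:R) * m%:R = k%:R * m%:R * (k%:R * b ^+ 2) by ring.
have -> : 2 * k%:R * (k%:R + 1) * (m%:R * ((a + b) ^+ 2 + a ^+ 2)) =
  k%:R * m%:R * ((k%:R + 1) * (2 * ((a + b) ^+ 2 + a ^+ 2))) by ring.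
apply: ler_wpM2l; first by rewrite mulr_ge0.
apply: ler_pM => //; first exact: sqr_ge0.
by rewrite lerDl.
Qed.

End Bounds.

(** * Assembling the bounds *)

Theorem proposition1 (R : realType) (n k : nat)
    (hn : (1 < n)%N) (hk : (0 < k)%N) (hkn : (k <= n)%N) :
  let L := laplacian R (platoon n k) in
  let nbar : R := (n./2)%:R in
  [/\ (k < n)%N ->
        Num.max (2 * k%:R - n%:R + 2)
                (k%:R * (k%:R + 1) ^+ 2 / (16 * nbar ^+ 2)) <= lambda2 L,
      k%:R * (k%:R + 1) ^+ 2 / (16 * nbar ^+ 2) <= lambda2 L
    & lambda2 L <= 2 * k%:R * (k%:R + 1) / nbar].
Proof.
move=> L nbar.
have nbar_gt0 : 0 < nbar by rewrite ltr0n; lia.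
have degree_bound m : (m <= k)%N -> (m < n)%N -> 2 * m%:R - n%:R + 2 <= lambda2 L.
  move=> mk mn; apply: (lambda2_ge_min_degree R (@platoon_sym n k)) => //.
    exact: platoon_irr.
  by move=> i; apply: platoon_degree.
have complete_bound : nbar * 4 >= n%:R + 1 -> n%:R <= lambda2 L ->
   k%:R * (k%:R + 1) ^+ 2 / (16 * nbar ^+ 2) <= lambda2 L.
  move=> n4 nL; apply: le_trans nL; rewrite ler_pdivrMr ?mulr_gt0 ?exprn_gt0 //.
  have kR : k%:R <= n%:R :> R by rewrite ler_nat.
  have -> : 16 * nbar ^+ 2 = (nbar * 4) ^+ 2 by ring.
  apply: ler_pM; rewrite ?exprn_ge0 ?addr_ge0 //.
  rewrite ler_pXn2r ?nnegrE ?addr_ge0 ?mulr_ge0 ?(ltW nbar_gt0) //.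
  by apply: le_trans n4; rewrite lerD2r.
have second : k%:R * (k%:R + 1) ^+ 2 / (16 * nbar ^+ 2) <= lambda2 L.
  have [kn|nk] := ltnP k n; last first.
    (* Here k = n and the platoon is the complete graph. *)
    have nL : n%:R <= lambda2 L.
      apply: le_trans (degree_bound n.-1 _ _); try lia.
      have -> : n.-1%:R = n%:R - 1 :> R by rewrite -[n in RHS]prednK ?natr1 -?natr1 ?addrK //; lia.
      by lra.
    apply: complete_bound nL; rewrite /nbar -natrM natr1 ler_nat; lia.
  have [n3|n3] := eqVneq n 3%N.
    have := degree_bound k (leqnn _) kn; apply: le_trans.
    have nb : nbar = 1 by rewrite /nbar n3.
    have : (k = 1 \/ k = 2)%N by lia.
    by rewrite nb n3 expr1n => -[->|->]; lra.
  apply: le_trans (lambda2_platoon_ge_poincare R hn hk kn).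
  have n1 : 0 < n%:R - 1 :> R by rewrite subr_gt0 ltr1n.
  have n0 : 0 < n%:R :> R by rewrite ltr0n; lia.
  rewrite ler_pM2l ?mulr_gt0 ?exprn_gt0 ?addr_gt0 ?ltr0n //.
  rewrite lef_pV2 ?posrE ?mulr_gt0 ?exprn_gt0 //.
  have : (3 * n * n.-1 <= 16 * n./2 ^ 2)%N.
    have : (n = n./2.*2 \/ n = n./2.*2.+1 /\ 2 <= n./2)%N by lia.
    by move: (n./2) => h; rewrite -mul2n => -[|[]] ->; nia.
  rewrite -(ler_nat R) !natrM -expr2 /nbar.
  by rewrite (_ : n.-1%:R = n%:R - 1) // -[n in RHS]prednK -?natr1 ?addrK //; lia.
split => //; last exact: lambda2_platoon_le.
by move=> kn; rewrite ge_max second degree_bound.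
Qed.
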